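(* Let $\mathcal{M}^1$ be the Lie antialgebra of formal series in the basis elements $\varepsilon_n$ ($n\ge0$), $a_i$ ($i\ge-\frac12$, $i\in\mathbb{Z}+\frac12$), and let $\varepsilon_n^*,a_i^*\in(\mathcal{M}^1)^*$ be the dual basis (coefficient) functionals. The bilinear map $\eta:\mathcal{M}^1\otimes\mathcal{M}^1\to(\mathcal{M}^1)^*$ given by $$\eta=a_{-\frac12}^*\wedge a_{\frac12}^*\otimes\varepsilon_0^*$$ is a non-trivial 2-cocycle on $\mathcal{M}^1$ (with coefficients in $(\mathcal{M}^1)^*$).
   Context: Vector spaces are over a field $\mathbb{K}$ of characteristic $0$. $\mathcal{M}^1$ is the $\mathbb{Z}_2$-graded commutative algebra (i.e. $a\cdot b=(-1)^{\bar a\bar b}b\cdot a$) of formal series in the even elements $\varepsilon_n$ ($n\ge0$ integer) and the odd elements $a_i$ ($i\in\mathbb{Z}+\frac12$, $i\ge-\frac12$), with relations $\varepsilon_n\cdot\varepsilon_m=\varepsilon_{n+m}$, $\varepsilon_n\cdot a_i=\frac12a_{n+i}$, $a_i\cdot a_j=\frac12(j-i)\varepsilon_{i+j}$. For $\mathfrak{a}=\mathcal{M}^1$, the dual space $\mathfrak{a}^*$ (graded by $\mathfrak{a}^*_i=(\mathfrak{a}_i)^*$) carries the action $\langle a\cdot u,b\rangle:=(-1)^{\bar u\bar a}\langle u,a\cdot b\rangle$ for $u\in\mathfrak{a}^*$, $a,b\in\mathfrak{a}$, and one sets $u\cdot a=(-1)^{\bar a\bar u}a\cdot u$. The cochain $\eta$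 is the element of $C^{0,2}(\mathfrak{a};\mathfrak{a}^* )$ with $\eta(y,y')=\big(a_{-\frac12}^*(y)a_{\frac12}^*(y')-a_{\frac12}^*(y)a_{-\frac12}^*(y')\big)\varepsilon_0^*$ for odd $y,y'$, and zero on all other pairs (even-even, even-odd). Cohomology of a Lie antialgebra $\mathfrak{a}$ with coefficients in $\mathcal{B}$ (here $\mathcal{B}=\mathfrak{a}^*$): for $p+q\ge1$, $C^{p,q}(\mathfrak{a};\mathcal{B})$ is the space of multilinear maps $\varphi:\mathfrak{a}_0^{\times p}\times\mathfrak{a}_1^{\times q}\to\mathcal{B}$, skew-symmetric in the $\mathfrak{a}_1$-variables, with values in $\mathcal{B}_0$ if $q$ is even and in $\mathcal{B}_1$ if $q$ is odd; $C^k=\bigoplus_{p+q=k}C^{p,q}$, $k\ge1$. On $\mathfrak{a}\oplus\mathcal{B}$, with product $(a,b)\cdot(a',b')=(a\cdot a',\,a\cdot b'+b\cdot a')$, put $m(u,v)=\frac12u\cdot v$ if $u,v$ are both even and $m(u,v)=u\cdot v$ if $(u,v)$ is (even, odd) or (odd, odd). The differential $\delta=\delta_{1,0}+\delta_{0,1}+\delta_{-1,2}:C^k\to C^{k+1}$, $\delta_{i,j}:C^{p,q}\to C^{p+i,q+j}$, is given for $\varphi\in C^{p,q}$ by: $\bullet$ $q=0$: $(\delta_{1,0}\varphi)(x_0,\ldots,x_p)=-m(x_0,\varphi(x_1,\ldots,x_p))+\sum_{i=0}^{p-1}(-1)^i\varphi(x_0,\ldots,m(x_i,x_{i+1}),\ldots,x_p)+(-1)^pm(\varphi(x_0,\ldots,x_{p-1}),x_p)$;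 $\bullet$ $q>0$: $(\delta_{1,0}\varphi)(x_0,\ldots,x_p;y_0,\ldots,y_{q-1})=-m(x_0,\varphi(x_1,\ldots,x_p;y_0,\ldots,y_{q-1}))+\sum_{i=0}^{p-1}(-1)^i\varphi(x_0,\ldots,m(x_i,x_{i+1}),\ldots,x_p;y_0,\ldots,y_{q-1})+\frac1q\sum_{j=0}^{q-1}(-1)^{p+j}\varphi(x_0,\ldots,x_{p-1};m(x_p,y_j),y_0,\ldots,\widehat{y_j},\ldots,y_{q-1})$; $\bullet$ $(\delta_{0,1}\varphi)(x_0,\ldots,x_{p-1};y_0,\ldots,y_q)=\frac{\kappa}{q+1}\sum_{j=0}^q(-1)^{p+j}m(\varphi(x_0,\ldots,x_{p-1};y_0,\ldots,\widehat{y_j},\ldots,y_q),y_j)$, with $\kappa=2$ if $p=0$ and $q$ is odd, and $\kappa=1$ otherwise; $\bullet$ $(\delta_{-1,2}\varphi)(x_0,\ldots,x_{p-2};y_0,\ldots,y_{q+1})=\frac{2}{(q+1)(q+2)}\sum_{i<j}(-1)^{p+i+j}\varphi(x_0,\ldots,x_{p-2},m(y_i,y_j);y_0,\ldots,\widehat{y_i},\ldots,\widehat{y_j},\ldots,y_{q+1})$ if $p>0$, and $\delta_{-1,2}\varphi=0$ if $p=0$. A 2-cocycle is an element of $\ker(\delta:C^2\to C^3)$; 2-coboundaries are the elements $\delta\zeta$, $\zeta\in C^1$ (parity preserving linear maps $\mathfrak{a}\to\mathcal{B}$). A cocycle is non-trivial if it is not a coboundary. *)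

(* Defs.v *)
(* MathComp, with the classical layer of MathComp-Analysis for the linear
   structure on spaces of functions. *)
From HB Require Import structures.
From mathcomp Require Import all_boot all_algebra perm.
From mathcomp Require Import boolp functions.

Set Implicit Arguments.
Unset Strict Implicit.
Unset Printing Implicit Defensive.

Import GRing.Theory.
Local Open Scope ring_scope.

(* The full algebraic dual V^*. *)
Section DualSpace.
Variables (K : fieldType) (V : lmodType K).

Definition dualsp := {scalar V}.

HB.instance Definition _ := gen_eqMixin dualsp.
HB.instance Definition _ := gen_choiceMixin dualsp.

Definition dapp (u : dualsp) : {scalar V} := u.

Definition mkdual (f : V -> K) (fP : scalar f) : dualsp :=
  HB.pack f (GRing.isLinear.Build K V K *%R f fP).

Lemma dualspP (u v : dualsp) : (forall b, dapp u b = dapp v b) -> u = v.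
Proof.
case: u v => [f cf] [g cg] /= H.
have fg : f = g by apply: funext => b; exact: H.
case: _ / fg cg {H} => cg; congr GRing.Linear.Pack.
case: cf cg => [[[a b]] [c]] [[[a' b']] [c']].
by rewrite (Prop_irrelevance a a') (Prop_irrelevance b b')
           (Prop_irrelevance c c').
Qed.

Fact dzero_subproof : scalar (fun _ : V => 0 : K).
Proof. by move=> k x y; rewrite mulr0 addr0. Qed.
Fact dadd_subproof (u v : dualsp) : scalar (fun b => dapp u b + dapp v b).
Proof. by move=> k x y; rewrite !linearP /= mulrDr addrACA. Qed.
Fact dopp_subproof (u : dualsp) : scalar (fun b => - dapp u b).
Proof. by move=> k x y; rewrite linearP /= opprD mulrN. Qed.
Fact dscale_subproof (a : K) (u : dualsp) : scalar (fun b => a * dapp u b).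
Proof. by move=> k x y; rewrite linearP /= mulrDr mulrCA. Qed.

Definition dzero := mkdual dzero_subproof.
Definition dadd u v := mkdual (dadd_subproof u v).
Definition dopp u := mkdual (dopp_subproof u).
Definition dscale a u := mkdual (dscale_subproof a u).

Fact daddA : associative dadd.
Proof. by move=> u v w; apply: dualspP => b; apply: addrA. Qed.
Fact daddC : commutative dadd.
Proof. by move=> u v; apply: dualspP => b; apply: addrC. Qed.
Fact dadd0 : left_id dzero dadd.
Proof. by move=> u; apply: dualspP => b; apply: add0r. Qed.
Fact daddN : left_inverse dzero dopp dadd.
Proof. by move=> u; apply: dualspP => b; apply: addNr. Qed.

HB.instance Definition _ :=
  GRing.isZmodule.Build dualsp daddA daddC dadd0 daddN.

Fact dscaleA a b u : dscale a (dscale b u) = dscale (a * b) u.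
Proof. by apply: dualspP => c; apply: mulrA. Qed.
Fact dscale1 : left_id 1 dscale.
Proof. by move=> u; apply: dualspP => b; apply: mul1r. Qed.
Fact dscaleDr : right_distributive dscale +%R.
Proof. by move=> a u v; apply: dualspP => b; apply: mulrDr. Qed.
Fact dscaleDl u : {morph dscale^~ u : a b / a + b}.
Proof. by move=> a b; apply: dualspP => c; apply: mulrDl. Qed.

HB.instance Definition _ := GRing.Zmodule_isLmodule.Build K dualsp
  dscaleA dscale1 dscaleDr dscaleDl.

Lemma dappD (u v : dualsp) b : dapp (u + v) b = dapp u b + dapp v b.
Proof. by []. Qed.
Lemma dappZ a (u : dualsp) b : dapp (a *: u) b = a * dapp u b.
Proof. by []. Qed.
End DualSpace.

(* A Z_2-graded commutative algebra a = a_0 (+) a_1.  The product of an odd by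
   an even element is not recorded: graded commutativity forces
   y . x = x . y = scmul01 x y. *)
Record scalg (K : fieldType) := Scalg {
  sc0 : lmodType K;
  sc1 : lmodType K;
  scmul00 : sc0 -> sc0 -> sc0;
  scmul01 : sc0 -> sc1 -> sc1;
  scmul11 : sc1 -> sc1 -> sc0;
  scmul00_bilin : bilinear_for *:%R *:%R scmul00;
  scmul01_bilin : bilinear_for *:%R *:%R scmul01;
  scmul11_bilin : bilinear_for *:%R *:%R scmul11;
  scmul00C : commutative scmul00;
  scmul11C : forall y z, scmul11 y z = - scmul11 z y
}.

(* Coefficients B = B_0 (+) B_1 with the left action of a; scact_ij is the
   action of a_i on B_j.  No module axiom beyond bilinearity enters the
   definition of the cochain spaces and of the differential. *)
Record scmod (K : fieldType) (A : scalg K) := Scmod {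
  sm0 : lmodType K;
  sm1 : lmodType K;
  scact00 : sc0 A -> sm0 -> sm0;
  scact01 : sc0 A -> sm1 -> sm1;
  scact10 : sc1 A -> sm0 -> sm1;
  scact11 : sc1 A -> sm1 -> sm0;
  scact00_bilin : bilinear_for *:%R *:%R scact00;
  scact01_bilin : bilinear_for *:%R *:%R scact01;
  scact10_bilin : bilinear_for *:%R *:%R scact10;
  scact11_bilin : bilinear_for *:%R *:%R scact11
}.

Definition sctot (K : fieldType) (A : scalg K) (B : scmod A) : lmodType K :=
  (sm0 B * sm1 B)%type.

Section Actions.
Variables (K : fieldType) (A : scalg K) (B : scmod A).
Implicit Types (x : sc0 A) (y : sc1 A) (u : sctot B).

Definition lact0 x u : sctot B := (scact00 x u.1, scact01 x u.2).
Definition lact1 y u : sctot B := (scact11 y u.2, scact10 y u.1).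

(* u . a = (-1)^(|a||u|) a . u *)
Definition ract0 u x : sctot B := lact0 x u.
Definition ract1 u y : sctot B := (- scact11 y u.2, scact10 y u.1).

(* The operation m on a (+) B: m(u, v) = 1/2 u.v if u and v are both even, and
   m(u, v) = u.v if they are (even, odd) or (odd, odd).  In mB0 only the even
   component of u is relevant: m is not defined on (odd, even) pairs. *)
Definition m00 x x' : sc0 A := 2^-1 *: scmul00 x x'.
Definition m01 x y : sc1 A := scmul01 x y.
Definition m11 y y' : sc0 A := scmul11 y y'.
Definition m0B x u : sctot B := (2^-1 *: (lact0 x u).1, (lact0 x u).2).
Definition mB0 u x : sctot B := (2^-1 *: (ract0 u x).1, 0).
Definition mB1 u y : sctot B := ract1 u y.
End Actions.

Section Lists.
Variable T : Type.

(* x_0, ..., x_(i-1), x_(i+1), ..., x_n *)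
Definition del n (i : 'I_n.+1) (x : {ffun 'I_n.+1 -> T}) : {ffun 'I_n -> T} :=
  [ffun k => x (lift i k)].

(* x_0, ..., x_(i-1), v, x_i, ..., x_(n-1) *)
Definition ins n (i : 'I_n.+1) (v : T) (x : {ffun 'I_n -> T}) :
    {ffun 'I_n.+1 -> T} :=
  [ffun k => oapp x v (unlift i k)].

Definition upd n (i : 'I_n) (v : T) (x : {ffun 'I_n -> T}) : {ffun 'I_n -> T} :=
  [ffun k => if k == i then v else x k].
End Lists.

(* x_0, ..., m(x_i, x_(i+1)), ..., x_p *)
Definition merge00 (K : fieldType) (A : scalg K) p (i : 'I_p)
    (x : {ffun 'I_p.+1 -> sc0 A}) : {ffun 'I_p -> sc0 A} :=
  let x_i := x (widen_ord (leqnSn p) i) in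
  let x_i1 := x (lift ord0 i) in
  upd i (m00 x_i x_i1) (del (lift ord0 i) x).

Definition multilinear (K : fieldType) (V W : lmodType K) n
    (f : {ffun 'I_n -> V} -> W) : Prop :=
  forall (i : 'I_n) (x : {ffun 'I_n -> V}), linear (fun v => f (upd i v x)).

Section Cohomology.
Variables (K : fieldType) (A : scalg K) (B : scmod A).

Definition precochain (p q : nat) : Type :=
  {ffun 'I_p -> sc0 A} -> {ffun 'I_q -> sc1 A} -> sctot B.

Definition is_pqcochain p q (f : precochain p q) : Prop :=
  [/\ forall y, multilinear (fun x => f x y),
      forall x, multilinear (f x),
      forall x (y : {ffun 'I_q -> sc1 A}) (s : 'S_q), f x [ffun k => y (s k)] = (-1) ^+ s *: f x y
    & forall x y, if odd q then (f x y).1 = 0 else (f x y).2 = 0].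

Definition cochains : Type := forall p q, precochain p q.

(* Elements of C^k, the direct sum of the C^(p,q) over p + q = k, given by
   their components (the components with p + q != k being zero). *)
Definition is_cochain (k : nat) (c : cochains) : Prop :=
  forall p q, if (p + q == k)%N then is_pqcochain (c p q)
              else forall x y, c p q x y = 0.

Definition delta10 p q : precochain p q -> precochain p.+1 q :=
  match q return precochain p q -> precochain p.+1 q with
  | 0 => fun f x y =>
      - m0B (x ord0) (f (del ord0 x) y)
      + \sum_(i < p) (-1) ^+ i *: f (merge00 i x) y
      + (-1) ^+ p *: mB0 (f (del ord_max x) y) (x ord_max)
  | q'.+1 => fun f x y =>
      - m0B (x ord0) (f (del ord0 x) y)
      + \sum_(i < p) (-1) ^+ i *: f (merge00 i x) y
      + (q'.+1)%:R^-1 *: \sum_(j < q'.+1) (-1) ^+ (p + j) *: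
          f (del ord_max x) (ins ord0 (m01 (x ord_max) (y j)) (del j y))
  end.

Definition delta01 p q (f : precochain p q) : precochain p q.+1 :=
  fun x y =>
    let kappa : K := if (p == 0)%N && odd q then 2 else 1 in
    (kappa / (q.+1)%:R) *:
      \sum_(j < q.+1) (-1) ^+ (p + j) *: mB1 (f x (del j y)) (y j).

(* The component C^(p+1,q) -> C^(p,q+2); it vanishes on C^(0,q).  For i < j
   one has del j y i = y i, and del i (del j y) omits y_i and y_j. *)
Definition deltaN2 p q (f : precochain p.+1 q) : precochain p q.+2 :=
  fun x y =>
    (2 / (q.+1 * q.+2)%:R) *:
      \sum_(j < q.+2) \sum_(i < q.+1 | (i < j)%N)
        (-1) ^+ (p.+1 + i + j) *:
          f (ins ord_max (m11 (del j y i) (y j)) x) (del i (del j y)).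

Definition delta10_comp (c : cochains) p q : precochain p q :=
  match p return precochain p q with
  | 0 => fun _ _ => 0
  | p'.+1 => delta10 (c p' q)
  end.

Definition delta01_comp (c : cochains) p q : precochain p q :=
  match q return precochain p q with
  | 0 => fun _ _ => 0
  | q'.+1 => delta01 (c p q')
  end.

Definition deltaN2_comp (c : cochains) p q : precochain p q :=
  match q return precochain p q with
  | q'.+2 => deltaN2 (c p.+1 q')
  | _ => fun _ _ => 0
  end.

Definition delta (c : cochains) : cochains := fun p q x y =>
  delta10_comp c x y + delta01_comp c x y + deltaN2_comp c x y.

Arguments delta c p q x y : clear implicits.

Definition is_cocycle (k : nat) (c : cochains) : Prop :=
  is_cochain k c /\ forall p q x y, delta c p q x y = 0.

(* c is delta z for some z in C^(k-1); meaningful for k >= 2, as C^k is only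
   considered for k >= 1. *)
Definition is_coboundary (k : nat) (c : cochains) : Prop :=
  exists2 z : cochains, is_cochain k.-1 z &
    forall p q x y, c p q x y = delta z p q x y.

Definition is_nontrivial_cocycle (k : nat) (c : cochains) : Prop :=
  is_cocycle k c /\ ~ is_coboundary k c.
End Cohomology.

(* <a . u, b> = (-1)^(|u||a|) <u, a . b>, where (a^* )_i = (a_i)^*. *)
Section DualModule.
Variables (K : fieldType) (A : scalg K).

Fact dact00_subproof (x : sc0 A) (u : dualsp (sc0 A)) :
  scalar (fun b => dapp u (scmul00 x b)).
Proof. by move=> k b c; rewrite (scmul00_bilin A).2 linearP. Qed.
Fact dact01_subproof (x : sc0 A) (u : dualsp (sc1 A)) :
  scalar (fun b => dapp u (scmul01 x b)).
Proof. by move=> k b c; rewrite (scmul01_bilin A).2 linearP. Qed.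
Fact dact10_subproof (y : sc1 A) (u : dualsp (sc0 A)) :
  scalar (fun b => dapp u (scmul11 y b)).
Proof. by move=> k b c; rewrite (scmul11_bilin A).2 linearP. Qed.
Fact dact11_subproof (y : sc1 A) (u : dualsp (sc1 A)) :
  scalar (fun b => - dapp u (scmul01 b y)).
Proof.
by move=> k b c; rewrite (scmul01_bilin A).1 linearP /= opprD mulrN.
Qed.

Definition dact00 x u := mkdual (dact00_subproof x u).
Definition dact01 x u := mkdual (dact01_subproof x u).
Definition dact10 y u := mkdual (dact10_subproof y u).
Definition dact11 y u := mkdual (dact11_subproof y u).

Fact dact00_bilin : bilinear_for *:%R *:%R dact00.
Proof.
split=> [u k x x'|x k u v]; apply: dualspP => b //.
by rewrite dappD dappZ /dapp /= (scmul00_bilin A).1 linearP.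
Qed.
Fact dact01_bilin : bilinear_for *:%R *:%R dact01.
Proof.
split=> [u k x x'|x k u v]; apply: dualspP => b //.
by rewrite dappD dappZ /dapp /= (scmul01_bilin A).1 linearP.
Qed.
Fact dact10_bilin : bilinear_for *:%R *:%R dact10.
Proof.
split=> [u k x x'|x k u v]; apply: dualspP => b //.
by rewrite dappD dappZ /dapp /= (scmul11_bilin A).1 linearP.
Qed.
Fact dact11_bilin : bilinear_for *:%R *:%R dact11.
Proof.
split=> [u k x x'|x k u v]; apply: dualspP => b.
  by rewrite dappD dappZ /dapp /= (scmul01_bilin A).2 linearP /= opprD mulrN.
by rewrite dappD dappZ /dapp /= opprD mulrN.
Qed.

Definition dualmod : scmod A :=
  Scmod dact00_bilin dact01_bilin dact10_bilin dact11_bilin.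
End DualModule.

Section M1.
Variable K : fieldType.

(* Formal series by their coefficients.  In the even part s n is the
   coefficient of eps_n; in the odd part s k is the coefficient of
   a_(k - 1/2), so that s 0 is the coefficient of a_(-1/2). *)
Definition fseries : lmodType K := (nat -> K^o)%type.

Definition basis (n : nat) : fseries := fun k => (k == n)%:R.

Definition M1mul00 (x x' : fseries) : fseries :=
  fun n => \sum_(i < n.+1) (x i : K) * x' (n - i)%N.

Definition M1mul01 (x y : fseries) : fseries :=
  fun k => 2^-1 * \sum_(i < k.+1) (x i : K) * y (k - i)%N.

(* a_(k-1/2) . a_(l-1/2) = 1/2 (l - k) eps_(k+l-1), so eps_n receives the pairs
   with k + l = n + 1; the pair k = l = 0 has coefficient zero. *)
Definition M1mul11 (y y' : fseries) : fseries :=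
  fun n => 2^-1 * \sum_(k < n.+2)
    ((n.+1 - k)%:R - k%:R) * ((y k : K) * y' (n.+1 - k)%N).

Lemma fsE (k : K) (s t : fseries) n : (k *: s + t) n = k * (s n : K) + (t n : K).
Proof. by []. Qed.

Fact M1mul00_bilin : bilinear_for *:%R *:%R M1mul00.
Proof.
split=> [u k x x'|u k x x']; apply: funext => n;
  rewrite fsE /M1mul00 mulr_sumr -big_split; apply: eq_bigr => i _;
  rewrite fsE /=.
- by rewrite mulrDl mulrA.
- by rewrite mulrDr mulrCA.
Qed.

Fact M1mul01_bilin : bilinear_for *:%R *:%R M1mul01.
Proof.
split=> [u k x x'|u k x x']; apply: funext => n;
  rewrite fsE /M1mul01 mulrCA -mulrDr; congr (_ * _);
  rewrite mulr_sumr -big_split; apply: eq_bigr => i _; rewrite fsE /=.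
- by rewrite mulrDl mulrA.
- by rewrite mulrDr mulrCA.
Qed.

Fact M1mul11_bilin : bilinear_for *:%R *:%R M1mul11.
Proof.
split=> [u k x x'|u k x x']; apply: funext => n;
  rewrite fsE /M1mul11 mulrCA -mulrDr; congr (_ * _);
  rewrite mulr_sumr -big_split; apply: eq_bigr => i _; rewrite fsE /= [X in _ = X + _]mulrCA -mulrDr;
  congr (_ * _).
- by rewrite mulrDl mulrA.
- by rewrite mulrDr mulrCA.
Qed.

Fact M1mul00C : commutative M1mul00.
Proof.
move=> x y; apply: funext => n; rewrite /M1mul00 (reindex_inj rev_ord_inj) /=.
by apply: eq_bigr => i _; rewrite subSS mulrC subKn // -ltnS.
Qed.

Fact M1mul11C y z : M1mul11 y z = - M1mul11 z y.
Proof.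
apply: funext => n.
change (M1mul11 y z n = - M1mul11 z y n).
rewrite /M1mul11 -mulrN -sumrN; congr (_ * _).
rewrite (reindex_inj rev_ord_inj) /=; apply: eq_bigr => i _.
rewrite subSS (subKn (_ : i <= n.+1)%N); last by rewrite -ltnS.
by rewrite -[RHS]mulNr opprB; congr (_ * _); apply: mulrC.
Qed.

Definition M1 : scalg K :=
  Scalg M1mul00_bilin M1mul01_bilin M1mul11_bilin M1mul00C M1mul11C.

Lemma cauchy_basis (w : nat -> K) n m r :
  \sum_(i < r.+1) w i * ((basis n i : K) * basis m (r - i)%N)
  = (r == n + m)%N%:R * w n.
Proof.
have [le_nr|lt_rn] := leqP n r.
- rewrite (bigD1 (Ordinal (le_nr : n < r.+1)%N)) //= big1 => [|i ni].
    rewrite /basis eqxx mul1r addr0 mulrC; congr (_%:R * _); congr nat_of_bool.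
    by rewrite -(eqn_add2l n) subnKC.
  by rewrite /basis -val_eqE in ni *; rewrite (negPf ni) mul0r mulr0.
- rewrite big1 => [|i _].
    by rewrite (_ : r == _ = false) ?mul0r // ltn_eqF // ltn_addr.
  rewrite /basis (_ : val i == n = false) ?mul0r ?mulr0 //.
  by rewrite ltn_eqF // (leq_trans (ltn_ord i)).
Qed.

Lemma M1_eps_eps n m : M1mul00 (basis n) (basis m) = basis (n + m)%N.
Proof.
apply: funext => r; rewrite /M1mul00.
under eq_bigr do rewrite -[_ * _]mul1r.
by rewrite (cauchy_basis (fun=> 1)) mulr1.
Qed.

Lemma M1_eps_a n k : M1mul01 (basis n) (basis k) = 2^-1 *: basis (n + k)%N.
Proof.
apply: funext => r; rewrite /M1mul01; congr (_ * _).
under eq_bigr do rewrite -[_ * _]mul1r.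
by rewrite (cauchy_basis (fun=> 1)) mulr1.
Qed.

Lemma M1_a_a k l :
  M1mul11 (basis k) (basis l) = (2^-1 * (l%:R - k%:R)) *: basis (k + l).-1%N.
Proof.
apply: funext => r; rewrite /M1mul11.
change (2^-1 * \sum_(i < r.+2) ((r.+1 - i)%:R - i%:R) *
          ((basis k i : K) * basis l (r.+1 - i)%N)
        = 2^-1 * (l%:R - k%:R) * basis (k + l).-1%N r).
rewrite -mulrA; congr (_ * _).
pose w (i : nat) : K := (r.+1 - i)%:R - i%:R.
rewrite [LHS](cauchy_basis w) /w mulrC.
case: eqP => [E|/eqP E].
  by rewrite E addKn /basis -E eqxx.
rewrite mulr0 /basis; case: (posnP (k + l)) => [/eqP|kl0].
  by rewrite addn_eq0 => /andP[/eqP -> /eqP ->]; rewrite subrr mul0r.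
by rewrite (_ : r == _ = false) ?mulr0 // -eqSS prednK //; apply/negbTE.
Qed.

Fact coefd_subproof (n : nat) : scalar (fun s : fseries => s n : K).
Proof. by []. Qed.

Definition coefd (n : nat) : dualsp fseries := mkdual (coefd_subproof n).

Definition eps_dual (n : nat) : dualsp (sc0 M1) := coefd n.
(* The functional of a_(k - 1/2). *)
Definition a_dual (k : nat) : dualsp (sc1 M1) := coefd k.

(* (a_(-1/2)^* /\ a_(1/2)^* ) (x) eps_0^* *)
Definition eta : cochains (dualmod M1) := fun p q =>
  match p, q return precochain (dualmod M1) p q with
  | 0, 2 => fun _ y =>
      let y0 := y ord0 in
      let y1 := y ord_max in
      ((dapp (a_dual 0) y0 * dapp (a_dual 1) y1
        - dapp (a_dual 1) y0 * dapp (a_dual 0) y1) *: eps_dual 0, 0)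
  | _, _ => fun _ _ => 0
  end.
End M1.

Arguments eta K p q x y : clear implicits.

(* Main.v *)
(* Write omega for a_(-1/2)^* /\ a_(1/2)^*, so that eta = omega (x) eps_0^*.
   The cocycle condition amounts to three facts: an even x acts on eps_0^* by
   its coefficient x_0; omega(xy, y') + omega(y, xy') = x_0 omega(y, y'); and
   y . eps_0^* = 1/2 omega(y, -), so that the remaining component is the
   alternating sum of omega(y_i, y_j) omega(y_k, -), which vanishes as omega is
   a determinant of 2-dimensional vectors.

   If eta = delta(f + g) with f even and g odd, then the (eps_0, eps_0)
   component gives <f(eps_0), eps_0> = 0, and the (eps_1, a_(-1/2)) component
   gives <g(a_(1/2)), a_(-1/2)> = <g(a_(-1/2)), a_(1/2)>.  With these, the
   (a_(-1/2), a_(1/2)) component evaluated at eps_0 reads 1 = 0. *)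
Require Import Defs.
From mathcomp Require Import all_boot all_algebra.
From mathcomp Require Import perm ring.
Import GRing.Theory.
Local Open Scope ring_scope.

Set Implicit Arguments.
Unset Strict Implicit.
Unset Printing Implicit Defensive.

(** * Argument lists of length at most two *)

Lemma ord2P (i : 'I_2) : i = ord0 \/ i = ord_max.
Proof. by case: i => [[|[|//]] lti]; [left|right]; apply: val_inj. Qed.

Definition args1 (T : Type) (a : T) : {ffun 'I_1 -> T} := [ffun=> a].
Definition args2 (T : Type) (a b : T) : {ffun 'I_2 -> T} :=
  [ffun i => if i == ord0 then a else b].

Lemma args1E (T : Type) (f : {ffun 'I_1 -> T}) : f = args1 (f ord0).
Proof. by apply/ffunP => i; rewrite ffunE ord1. Qed.

Lemma args2E (T : Type) (f : {ffun 'I_2 -> T}) :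
  f = args2 (f ord0) (f ord_max).
Proof. by apply/ffunP => i; rewrite ffunE; case: (ord2P i) => ->. Qed.

Lemma del0_args2 (T : Type) (a b : T) : del ord0 (args2 a b) = args1 b.
Proof. by apply/ffunP => i; rewrite !ffunE. Qed.

Lemma del1_args2 (T : Type) (i : 'I_2) (a b : T) :
  i != ord0 -> del i (args2 a b) = args1 a.
Proof.
by case: (ord2P i) => -> // _; apply/ffunP => k; rewrite !ffunE ord1.
Qed.

Lemma ffun0E (T : Type) (f g : {ffun 'I_0 -> T}) : f = g.
Proof. by apply/ffunP => -[]. Qed.

Lemma ins_ord0 (T : Type) (i : 'I_1) (a : T) (f : {ffun 'I_0 -> T}) :
  ins i a f = args1 a.
Proof. by rewrite (args1E (ins i a f)) ffunE (ord1 i) unlift_none. Qed.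

Lemma ins_ord1 (T : Type) (a b : T) : ins ord0 a (args1 b) = args2 a b.
Proof.
apply/ffunP => i; rewrite !ffunE.
by case: unliftP => [j|] -> /=; rewrite ?ffunE.
Qed.

Lemma upd_ord0 (T : Type) (i : 'I_1) (a : T) (f : {ffun 'I_1 -> T}) :
  upd i a f = args1 a.
Proof. by rewrite (args1E (upd i a f)) ffunE (ord1 i). Qed.

(** * Components of the differential from C^1 to C^2 *)

Section LowDegree.
Variables (K : fieldType) (A : scalg K) (B : scmod A).
Implicit Types (c : cochains B) (x : sc0 A) (y : sc1 A).

Lemma delta_20E c x x' (y : {ffun 'I_0 -> sc1 A}) :
  delta c (args2 x x') y =
  - m0B x (c 1 0 (args1 x') y) + c 1 0 (args1 (m00 x x')) y
  - mB0 (c 1 0 (args1 x) y) x'.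
Proof.
rewrite /delta /= !addr0 /delta10 big_ord1 expr0 expr1 scale1r scaleN1r.
by rewrite del0_args2 del1_args2 // !ffunE /= (args1E (merge00 _ _)) !ffunE.
Qed.

Lemma delta_11E c x y (x0 : {ffun 'I_0 -> sc0 A}) (y0 : {ffun 'I_0 -> sc1 A}) :
  delta c (args1 x) (args1 y) =
  - m0B x (c 0 1 x0 (args1 y)) + c 0 1 x0 (args1 (m01 x y))
  - mB1 (c 1 0 (args1 x) y0) y.
Proof.
rewrite /delta /= !addr0 /delta10 /delta01 big_ord0 !big_ord1 /=.
rewrite invr1 expr0 expr1 !scale1r scaleN1r addr0 !ffunE.
rewrite !(ffun0E (del _ _) x0) (ffun0E (del _ _) y0).
by rewrite ins_ord0 mulr1 scale1r.
Qed.

Lemma delta_02E c (x0 : {ffun 'I_0 -> sc0 A}) (y0 : {ffun 'I_0 -> sc1 A}) y y' :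
  (2 : K) != 0 ->
  delta c x0 (args2 y y') =
  mB1 (c 0 1 x0 (args1 y')) y - mB1 (c 0 1 x0 (args1 y)) y'
  + c 1 0 (args1 (m11 y y')) y0.
Proof.
move=> nz2.
rewrite /delta /= add0r /delta01 /deltaN2 !big_ord_recl !big_ord0 /= !addr0.
(* The index j = 0 leaves no i < j. Both normalizing factors are 2 / 2: kappa = 2 over q + 1 = 2 in
   [delta01], and 2 / (1 * 2) in [deltaN2]. *)
rewrite big_pred0_eq add0r mul1n divff // !scale1r.
rewrite big_mkcond big_ord1 /= del0_args2 del1_args2 // !ffunE /=.
rewrite !exprS expr0 !mulr1 mulN1r opprK scale1r scaleN1r.
by rewrite ins_ord0 (ffun0E (del _ _) y0).
Qed.
End LowDegree.

Lemma linear_fun0 (K : fieldType) (V W : lmodType K) (f : V -> W) :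
  linear f -> f 0 = 0.
Proof. by move=> /(_ (-1) 0 0); rewrite scaler0 addr0 scaleN1r addNr. Qed.

Lemma linear_funZ (K : fieldType) (V W : lmodType K) (f : V -> W) a u :
  linear f -> f (a *: u) = a *: f u.
Proof. by move=> fL; rewrite -[a *: u]addr0 fL (linear_fun0 fL) addr0. Qed.

(** * Purely even values, and the differential on vanishing components *)

Section ZeroCochain.
Variables (K : fieldType) (A : scalg K) (B : scmod A).

Lemma m0B_even (x : sc0 A) (u : sm0 B) :
  m0B x ((u, 0) : sctot B) = (2^-1 *: scact00 x u, 0).
Proof. by rewrite /m0B /= (linear_fun0 ((scact01_bilin B).2 x)). Qed.

Lemma mB1_even (u : sm0 B) (y : sc1 A) :
  mB1 ((u, 0) : sctot B) y = (0, scact10 y u).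
Proof.
by rewrite /mB1 /ract1 /= (linear_fun0 ((scact11_bilin B).2 y)) oppr0.
Qed.

Lemma m0Bx0 (x : sc0 A) : m0B x (0 : sctot B) = 0.
Proof.
by rewrite (m0B_even x 0) (linear_fun0 ((scact00_bilin B).2 x)) scaler0.
Qed.

Lemma mB00x (x : sc0 A) : mB0 (0 : sctot B) x = 0.
Proof. by rewrite /mB0 /= (linear_fun0 ((scact00_bilin B).2 x)) scaler0. Qed.

Lemma mB10x (y : sc1 A) : mB1 (0 : sctot B) y = 0.
Proof. by rewrite (mB1_even 0 y) (linear_fun0 ((scact10_bilin B).2 y)). Qed.

Lemma pqcochain0 p q (f : precochain B p q) :
  (forall x y, f x y = 0) -> is_pqcochain f.
Proof.
move=> f0; split=> [y i x k u v|x i y k u v|x y s|x y];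
  rewrite !f0 ?scaler0 ?addr0 //.
by case: ifP.
Qed.

Lemma delta10_0 p q (f : precochain B p q) x y :
  (forall x y, f x y = 0) -> delta10 f x y = 0.
Proof.
rewrite /delta10; case: q f y => [|q'] f y f0; rewrite !f0 m0Bx0 oppr0 add0r.
  by rewrite mB00x scaler0 addr0 big1 // => i _; rewrite f0 scaler0.
by rewrite !big1 ?scaler0 ?addr0 // => i _; rewrite f0 scaler0.
Qed.

Lemma delta01_0 p q (f : precochain B p q) x y :
  (forall x y, f x y = 0) -> delta01 f x y = 0.
Proof.
move=> f0.
by rewrite /delta01 big1 ?scaler0 // => j _; rewrite f0 mB10x scaler0.
Qed.

Lemma deltaN2_0 p q (f : precochain B p.+1 q) x y :
  (forall x y, f x y = 0) -> deltaN2 f x y = 0.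
Proof.
move=> f0; rewrite /deltaN2 big1 ?scaler0 // => j _.
by rewrite big1 // => i _; rewrite f0 scaler0.
Qed.
End ZeroCochain.

(** Each projection chosen here involves only the even part f of the (1,0) component of the
    primitive and the odd part g of its (0,1) component. The signs of the last identity come from u
    . y = - y . u for odd u and y. *)
Lemma coboundary2P (K : fieldType) (A : scalg K) (B : scmod A)
    (c : cochains B) :
  (2 : K) != 0 -> is_coboundary 2 c ->
  exists (f : sc0 A -> sm0 B) (g : sc1 A -> sm1 B),
  [/\ linear f /\ linear g,
      forall x x' y, (c 2%N 0%N (args2 x x') y).1 =
        f (m00 x x') - 2^-1 *: (scact00 x (f x') + scact00 x' (f x)),
      forall x y, (c 1%N 1%N (args1 x) (args1 y)).2 =
        g (m01 x y) - scact01 x (g y) - scact10 y (f x) &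
      forall x y y', (c 0%N 2%N x (args2 y y')).1 =
        f (m11 y y') - scact11 y (g y') + scact11 y' (g y)].
Proof.
move=> nz2 [z zC dz].
(* [e0] and [f0] are the empty lists; the single entry of [e1] and [f1] is a filler that [upd]
   overwrites. *)
pose e0 : {ffun 'I_0 -> sc0 A} := [ffun=> 0].
pose f0 : {ffun 'I_0 -> sc1 A} := [ffun=> 0].
pose e1 : {ffun 'I_1 -> sc0 A} := [ffun=> 0].
pose f1 : {ffun 'I_1 -> sc1 A} := [ffun=> 0].
exists (fun x => (z 1%N 0%N (args1 x) f0).1).
exists (fun y => (z 0%N 1%N e0 (args1 y)).2).
split.
- split=> k u v.
    have [/(_ f0 ord0)/(_ e1) fL _ _ _] := zC 1%N 0%N.
    by have := fL k u v; rewrite !upd_ord0 => /(congr1 fst).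
  have [_ /(_ e0 ord0)/(_ f1) gL _ _] := zC 0%N 1%N.
  by have := gL k u v; rewrite !upd_ord0 => /(congr1 snd).
- move=> x x' y; rewrite (ffun0E y f0) dz delta_20E /=.
  by rewrite scalerDr opprD addrA (addrC (- _)).
- move=> x y; rewrite dz (delta_11E _ _ _ e0 f0) /=.
  by rewrite (addrC (- _)).
- move=> x y y'; rewrite (ffun0E x e0) dz (delta_02E _ e0 f0) //=.
  by rewrite opprK addrC addrA.
Qed.

(** * The cocycle condition for eta *)

Section Eta.
Variable K : fieldType.

Definition omega (y y' : fseries K) : K :=
  (y 0%N : K) * y' 1%N - (y 1%N : K) * y' 0%N.

Lemma eta02E (x : {ffun 'I_0 -> sc0 (M1 K)}) (y : {ffun 'I_2 -> sc1 (M1 K)}) :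
  eta K 0%N 2%N x y = (omega (y ord0) (y ord_max) *: eps_dual K 0, 0).
Proof. by []. Qed.

Lemma M1mul00_0 (x x' : fseries K) : M1mul00 x x' 0%N = (x 0%N : K) * x' 0%N.
Proof. by rewrite /M1mul00 big_ord1. Qed.

Lemma M1mul01_0 (x y : fseries K) :
  M1mul01 x y 0%N = 2^-1 * ((x 0%N : K) * y 0%N).
Proof. by rewrite /M1mul01 big_ord1. Qed.

Lemma M1mul01_1 (x y : fseries K) :
  M1mul01 x y 1%N = 2^-1 * ((x 0%N : K) * y 1%N + (x 1%N : K) * y 0%N).
Proof. by rewrite /M1mul01 big_ord_recl big_ord1. Qed.

(** Only a_(-1/2) and a_(1/2), in either order, multiply to a multiple of eps_0. Read as a function
    of y', this gives y . eps_0^* = 1/2 omega(y, -). *)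
Lemma M1mul11_0 (y y' : fseries K) : M1mul11 y y' 0%N = 2^-1 * omega y y'.
Proof.
rewrite /M1mul11 big_ord_recl big_ord1 /omega /= !subr0 sub0r subnn.
by rewrite mul1r mulN1r.
Qed.

Lemma omega_perm (y : 'I_2 -> fseries K) (s : 'S_2) :
  omega (y (s ord0)) (y (s ord_max)) =
  (-1) ^+ s * omega (y ord0) (y ord_max).
Proof.
have sym z z' : omega z z' = - omega z' z by rewrite /omega; ring.
case: (ord2P (s ord0)) => s0; case: (ord2P (s ord_max)) => s1.
- by have := perm_inj (etrans s0 (esym s1)).
- rewrite (_ : s = 1%g) ?odd_perm1 ?perm1 ?mul1r //.
  by apply/permP => i; rewrite perm1; case: (ord2P i) => ->.
- rewrite (_ : s = tperm ord0 ord_max) ?odd_tperm ?tpermL ?tpermR ?mulN1r //.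
  by apply/permP => i; case: (ord2P i) => ->; rewrite ?tpermL ?tpermR.
- by have := perm_inj (etrans s0 (esym s1)).
Qed.

Lemma omega_bilin : bilinear_for *%R *%R omega.
Proof.
by split=> [u k x y|u k x y]; rewrite /omega !fsE /=; ring.
Qed.

Lemma eta02_pqcochain : is_pqcochain (eta K 0%N 2%N).
Proof.
split=> [y []|x i y k u v|x y s|x y] //; rewrite !eta02E.
- apply: injective_projections; last by rewrite /= scaler0 addr0.
  rewrite /= scalerA -scalerDl !ffunE; congr (_ *: _).
  by case: (ord2P i) => -> /=; [apply: omega_bilin.1|apply: omega_bilin.2].
- apply: injective_projections; last by rewrite /= scaler0.
  by rewrite /= !ffunE scalerA omega_perm.
Qed.

Lemma eta_cochain : is_cochain (B := dualmod (M1 K)) 2 (eta K).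
Proof.
move=> [|[|[|p]]] [|[|[|q]]] //=; try exact: pqcochain0.
exact: eta02_pqcochain.
Qed.

Lemma delta10_eta x y :
  (2 : K) != 0 -> delta10 (eta K 0%N 2%N) x y = 0.
Proof.
move=> nz2.
rewrite (args1E x) (args2E y) /delta10 big_ord0 addr0 !big_ord_recl big_ord0.
rewrite !eta02E addr0 del0_args2 del1_args2 // !ins_ord1 !ffunE.
rewrite /= m0B_even; move: (x ord0) (y ord0) (y ord_max) => {}x z z'.
apply: injective_projections; last first.
  by rewrite /= oppr0 !scaler0 !addr0 scaler0 addr0.
apply: dualspP => b.
change (- (2^-1 * (omega z z' * M1mul00 x b 0%N)) +
  2^-1 * ((-1) ^+ 0 * (omega (M1mul01 x z) z' * (b 0%N : K)) +
          (-1) ^+ 1 * (omega (M1mul01 x z') z * (b 0%N : K))) = 0).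
rewrite M1mul00_0 /omega !M1mul01_0 !M1mul01_1.
(* On the coordinates (y_0, y_1), multiplication by x is triangular with both diagonal entries x_0 /
   2. Its trace x_0 is the factor by which it acts, as a derivation, on the determinant omega; the
   x_1 terms cancel. The 1/2 of [m0B] matches 1/q = 1/2. *)
by field.
Qed.

Lemma delta01_eta x y : delta01 (eta K 0%N 2%N) x y = 0.
Proof.
rewrite /delta01 !big_ord_recl big_ord0 !eta02E !ffunE.
(* Indexing by naturals lets the nested lifts produced by [del] compute to 0, 1, 2. *)
pose g n := y (inord n).
have yE i : y i = g i by rewrite /g inord_val.
rewrite !mB1_even !yE /=.
move: (g 0%N) (g 1%N) (g 2%N) => y0 y1 y2.
apply: injective_projections; first by rewrite /= !scaler0 !addr0 scaler0.
apply: dualspP => b; rewrite /= !M1mul11_0 /omega /bump /=.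
(* This is the three-term Plücker relation for the plane vectors given by the first two coordinates
   of y0, y1, y2 and b. *)
by ring.
Qed.

(** Since eta is concentrated in C^(0,2), [deltaN2] sees only zero components, [delta10] can
    contribute only in bidegree (1,2), and [delta01] only in (0,3). *)
Lemma delta_eta p q x y :
  (2 : K) != 0 -> delta (eta K) (p := p) (q := q) x y = 0.
Proof.
move=> nz2.
rewrite /delta; have -> : deltaN2_comp (eta K) x y = 0.
  by case: q y => [|[|q]] y //; apply: deltaN2_0.
have -> : delta10_comp (eta K) x y = 0.
  case: p x => [|[|p]] x //; last exact: (@delta10_0 _ _ (dualmod (M1 K))).
  case: q y => [|[|[|q]]] y; try exact: (@delta10_0 _ _ (dualmod (M1 K))).
  exact: delta10_eta.
rewrite add0r addr0.
case: q y => [|[|[|[|q]]]] y //; case: p x => [|p] x;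
  try exact: (@delta01_0 _ _ (dualmod (M1 K))).
exact: delta01_eta.
Qed.
End Eta.

(** * Non-triviality of eta *)

Lemma eta_not_coboundary (K : fieldType) : (2 : K) != 0 ->
  ~ is_coboundary (B := dualmod (M1 K)) 2 (eta K).
Proof.
move=> nz2 /(coboundary2P nz2)[f [g [[fL gL] d20 d11 d02]]].
pose e n : sc0 (M1 K) := basis K n; pose a n : sc1 (M1 K) := basis K n.
have ee : scmul00 (e 0%N) (e 0%N) = e 0%N by exact: M1_eps_eps.
have ea n m : scmul01 (e n) (a m) = 2^-1 *: a (n + m)%N by exact: M1_eps_a.
have a01 : scmul11 (a 0%N) (a 1%N) = 2^-1 *: e 0%N.
  by rewrite [LHS]M1_a_a subr0 mulr1.
have a00 : scmul11 (a 0%N) (a 0%N) = 0.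
  by rewrite [LHS]M1_a_a subrr mulr0 scale0r.
have f0 : dapp (f (e 0%N)) (e 0%N) = 0.
  have := congr1 (fun u => dapp u (e 0%N)) (d20 (e 0%N) (e 0%N) [ffun=> 0]).
  rewrite /m00 ee (linear_funZ _ _ fL).
  change (0 = 2^-1 * dapp (f (e 0%N)) (e 0%N) -
     2^-1 * (dapp (f (e 0%N)) (scmul00 (e 0%N) (e 0%N)) +
             dapp (f (e 0%N)) (scmul00 (e 0%N) (e 0%N))) ->
     dapp (f (e 0%N)) (e 0%N) = 0).
  rewrite ee => E.
  (* With t the left-hand side, [E] reads 0 = t/2 - t; the product with 0 is written out so that [E]
     can replace that 0. *)
  have -> : dapp (f (e 0%N)) (e 0%N) = - 2 * 0 by rewrite E; field.
  by rewrite mulr0.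
(* eps_1 sends a_(-1/2) to half of a_(1/2), and a_(-1/2) squares to zero, so evaluating at a_(-1/2)
   removes f(eps_1). *)
have gS : dapp (g (a 1%N)) (a 0%N) = dapp (g (a 0%N)) (a 1%N).
  have := congr1 (fun u => dapp u (a 0%N)) (d11 (e 1%N) (a 0%N)).
  rewrite /m01 ea (linear_funZ _ _ gL).
  change (0 = 2^-1 * dapp (g (a 1%N)) (a 0%N) -
    dapp (g (a 0%N)) (scmul01 (e 1%N) (a 0%N)) -
    dapp (f (e 1%N)) (scmul11 (a 0%N) (a 0%N)) ->
     dapp (g (a 1%N)) (a 0%N) = dapp (g (a 0%N)) (a 1%N)).
  rewrite ea a00 linearZ linear0 /= subr0 -mulrBr => /esym/eqP.
  by rewrite mulf_eq0 invr_eq0 (negPf nz2) subr_eq0 => /eqP.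
have := congr1 (fun u => dapp u (e 0%N)) (d02 [ffun=> 0] (a 0%N) (a 1%N)).
rewrite eta02E !ffunE /m11 a01 (linear_funZ _ _ fL).
change ((1 * 1 - 0 * 0) * 1 =
  2^-1 * dapp (f (e 0%N)) (e 0%N)
  - - dapp (g (a 1%N)) (scmul01 (e 0%N) (a 0%N))
  + - dapp (g (a 0%N)) (scmul01 (e 0%N) (a 1%N)) -> False).
(* eps_0 acts on odd elements as 1/2, so the two g terms are halves of the sides of [gS], with
   opposite signs once the minus of [dact11] is counted. *)
rewrite f0 !ea !linearZ /= gS add0n !mulr0 add0r opprK subrr !mulr1 subr0.
by move/eqP; rewrite oner_eq0.
Qed.

Unset Implicit Arguments.

Theorem theorem3 (K : fieldType) (charK0 : [pchar K] =i pred0) :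
  is_nontrivial_cocycle (B := dualmod (M1 K)) 2 (eta K).
Proof.
(* As 2 is prime, 2 = 0 in K would put it in [[pchar K]]. *)
have nz2 : (2 : K) != 0 by have := charK0 2%N; rewrite !inE /= => ->.
split; last exact: eta_not_coboundary.
by split=> [|p q x y]; [exact: eta_cochain | exact: delta_eta].
Qed.
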